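(* Let a finite directed acyclic precedence graph on blocks $\{1,\dots,n\}$ be given, let $w\in\mathbb{R}^n$ and $\gamma>0$, and let $\hat f(x)=-w^\top x+\gamma V_{\mathrm{anc}}(x)$ over $[0,1]^n$, where $$V_{\mathrm{anc}}(x):=\sum_{c=1}^n\ \sum_{\alpha\in \mathrm{Anc}(c)}x_c(1-x_\alpha).$$ Assume that core binarity holds, i.e. every local minimizer of $\hat f$ over $[0,1]^n$ lies in $\{0,1\}^n$. Then $V_{\mathrm{anc}}$ is locally repairable with margin $\delta=1$ relative to the single-bit removal directions $D:=\{-e_i: i=1,\dots,n\}$. Moreover, if $\gamma>\max_i w_i$, then every binary local minimizer of $\hat f$ over $[0,1]^n$ is feasible.
   Context: For each block $i$, $P(i)\subseteq\{1,\dots,n\}$ is the set of its predecessors, which must be extracted before $i$; the graph with an edge $j\to i$ for each $j\in P(i)$ is acyclic. $\mathrm{Anc}(c)$ is the set of all strict ancestors of $c$, i.e. nodes from which $c$ can be reached by a directed path of length at least one. A binary point $x\in\{0,1\}^n$ is feasible if $x_i\le x_j$ for all $i$ and all $j\in P(i)$, and infeasible otherwise. The tangent cone of the box at $x\in[0,1]^n$ is $T(x):=\{d\in\mathbb{R}^n: x_i=0\Rightarrow d_i\ge0,\ x_i=1\Rightarrow d_i\le 0\}$. Here $V_{\mathrm{anc}}$ is locally repairable with margin $\delta$ relative to $D$ if for every infeasible $x\in\{0,1\}^n$ there is $d\in D\cap T(x)$ with $\langle\nabla V_{\mathrm{anc}}(x),d\rangle\le-\delta$. The vectors $e_i$ are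 the standard basis vectors of $\mathbb{R}^n$. A local minimizer over $[0,1]^n$ is a point of the box minimizing $\hat f$ among all points of the box in some neighborhood of it. *)

(* Defs.v *)
From HB Require Import structures.
From mathcomp Require Import all_boot all_order all_algebra.
From mathcomp Require Import all_classical all_reals all_analysis.

Set Implicit Arguments.
Unset Strict Implicit.
Unset Printing Implicit Defensive.

Import Order.TTheory GRing.Theory Num.Theory.
Import numFieldNormedType.Exports.

Local Open Scope classical_set_scope.
Local Open Scope ring_scope.

(* A precedence graph is given by its predecessor sets P : 'I_n -> {set 'I_n};
   the edge j -> i means that j \in P i. *)
Definition prec_edge (n : nat) (P : 'I_n -> {set 'I_n}) : rel 'I_n :=
  [rel j i | j \in P i].

(* The empty sequence is a degenerate cycle in path.v; self-loops are
   nonempty cycles. *)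
Definition acyclic (n : nat) (P : 'I_n -> {set 'I_n}) : Prop :=
  forall s : seq 'I_n, cycle (prec_edge P) s -> s = [::].

(* An edge followed by a possibly empty path: [connect] is reflexive. *)
Definition Anc (n : nat) (P : 'I_n -> {set 'I_n}) (c : 'I_n) : {set 'I_n} :=
  [set a | [exists b, prec_edge P a b && connect (prec_edge P) b c]].

Definition dot (R : realType) (n : nat) (u v : 'rV[R]_n) : R :=
  \sum_(i < n) u 0 i * v 0 i.

Definition grad (R : realType) (n : nat) (f : 'rV[R]_n -> R) (x : 'rV[R]_n) :
  'rV[R]_n := \row_i 'D_(delta_mx 0 i) f x.

Definition box (R : realType) (n : nat) : set 'rV[R]_n :=
  [set x | forall i, 0 <= x 0 i <= 1].

Definition binary (R : realType) (n : nat) : set 'rV[R]_n :=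
  [set x | forall i, x 0 i = 0 \/ x 0 i = 1].

Definition feasible (R : realType) (n : nat) (P : 'I_n -> {set 'I_n})
  (x : 'rV[R]_n) : Prop :=
  forall i j, j \in P i -> x 0 i <= x 0 j.

Definition tangent_cone (R : realType) (n : nat) (x : 'rV[R]_n) :
  set 'rV[R]_n :=
  [set d | forall i, (x 0 i = 0 -> 0 <= d 0 i) /\ (x 0 i = 1 -> d 0 i <= 0)].

Definition local_minimizer (R : realType) (n : nat) (f : 'rV[R]_n -> R)
  (x : 'rV[R]_n) : Prop :=
  box x /\ \forall y \near x, box y -> f x <= f y.

Definition locally_repairable (R : realType) (n : nat)
  (P : 'I_n -> {set 'I_n}) (V : 'rV[R]_n -> R) (delta : R)
  (D : set 'rV[R]_n) : Prop :=
  forall x : 'rV[R]_n, binary x -> ~ feasible P x ->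
    exists2 d, (D `&` tangent_cone x) d & dot (grad V x) d <= - delta.

Definition Vanc (R : realType) (n : nat) (P : 'I_n -> {set 'I_n})
  (x : 'rV[R]_n) : R :=
  \sum_(c < n) \sum_(a in Anc P c) x 0 c * (1 - x 0 a).

Definition fhat (R : realType) (n : nat) (P : 'I_n -> {set 'I_n})
  (w : 'rV[R]_n) (gamma : R) (x : 'rV[R]_n) : R :=
  - dot w x + gamma * Vanc P x.

Definition removal_directions (R : realType) (n : nat) : set 'rV[R]_n :=
  range (fun i : 'I_n => - delta_mx 0 i).

Definition core_binarity (R : realType) (n : nat) (f : 'rV[R]_n -> R) : Prop :=
  forall x, local_minimizer f x -> binary x.

(* Main.v *)
(* Both Vanc and fhat are affine along each coordinate axis, since a block is never
   its own ancestor.  Among the active blocks with an inactive ancestor, let c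
   have the most ancestors.  An active descendant of c would inherit the
   inactive ancestor while having strictly more ancestors, so c has no active
   descendant and the slope of Vanc along c is at least 1.  Hence removing c
   decreases Vanc at rate at least 1, and decreases fhat when gamma > w_c. *)

Require Import Defs.
From HB Require Import structures.
From mathcomp Require Import all_boot all_order all_algebra.
From mathcomp Require Import all_classical all_reals all_analysis.
From mathcomp Require Import ring.

Set Implicit Arguments.
Unset Strict Implicit.
Unset Printing Implicit Defensive.

Import Order.TTheory GRing.Theory Num.Theory.
Import numFieldNormedType.Exports.

Local Open Scope classical_set_scope.
Local Open Scope ring_scope.

Section AncestorOrder.
Variables (n : nat) (P : 'I_n -> {set 'I_n}).

Lemma mem_Anc_prec i j : j \in P i -> j \in Anc P i.
Proof.
move=> ji; rewrite inE; apply/existsP; exists i.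
by apply/andP; split; [exact: ji | exact: connect0].
Qed.

Lemma Anc_trans a b c : a \in Anc P b -> b \in Anc P c -> a \in Anc P c.
Proof.
rewrite !inE => /existsP[b' /andP[ab' b'b]] /existsP[c' /andP[bc' c'c]].
apply/existsP; exists b'; rewrite ab' /=.
exact: connect_trans b'b (connect_trans (connect1 bc') c'c).
Qed.

(** An edge from [c] to [b] followed by a path from [b] back to [c] would close up into a nonempty
    cycle. *)
Lemma Anc_irrefl c : acyclic P -> c \notin Anc P c.
Proof.
move=> acycP; apply/negP; rewrite inE => /existsP[b /andP[cb /connectP[p bp cE]]].
suff /acycP : cycle (prec_edge P) (b :: p) by [].
by rewrite /= rcons_path bp -cE.
Qed.

(** Transitivity gives the inclusion; it is strict because [b] itself lies only in the larger
    set. *)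
Lemma card_Anc_lt b c : acyclic P -> b \in Anc P c -> (#|Anc P b| < #|Anc P c|)%N.
Proof.
move=> acycP bc; apply: proper_card; apply/properP; split.
  by apply/fintype.subsetP => a ab; apply: Anc_trans ab bc.
by exists b => //; apply: Anc_irrefl.
Qed.

End AncestorOrder.

(** The difference quotient equals [s] at every nonzero [t], so its limit is that of a constant. *)
Lemma derive_affine (R : realType) (n : nat) (f : 'rV[R]_n -> R)
    (x v : 'rV[R]_n) (s : R) :
  (forall t, f (x + t *: v) = f x + t * s) -> 'D_v f x = s.
Proof.
move=> fE; rewrite /derive; apply: cvg_lim => //.
apply: cvg_near_cst; near=> t.
have t0 : t != 0 by near: t; exact: nbhs_dnbhs_neq.
by rewrite /= [_ + x]addrC fE addrAC subrr add0r /GRing.scale /= mulKf.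
Unshelve. all: by end_near. Qed.

Section CoordinateSlope.
Variables (R : realType) (n : nat) (P : 'I_n -> {set 'I_n}).
Implicit Types (x w : 'rV[R]_n) (c : 'I_n) (t gamma : R).

(** The partial derivative of [Vanc] along [c]: the first sum comes from the pairs with [c] as
    descendant, the second from those with [c] as ancestor. *)
Definition Vanc_slope x c : R :=
  \sum_(a in Anc P c) (1 - x 0 a) - \sum_(d | c \in Anc P d) x 0 d.

Lemma add_deltaE x c t d : (x + t *: delta_mx 0 c) 0 d = x 0 d + t * (d == c)%:R.
Proof. by rewrite !mxE. Qed.

Lemma Vanc_add_delta x c t : acyclic P ->
  Vanc P (x + t *: delta_mx 0 c) = Vanc P x + t * Vanc_slope x c.
Proof.
move=> acycP.
have termE d a : a \in Anc P d ->
    (x + t *: delta_mx 0 c) 0 d * (1 - (x + t *: delta_mx 0 c) 0 a) =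
    x 0 d * (1 - x 0 a) +
    t * ((d == c)%:R * (1 - x 0 a) - x 0 d * (a == c)%:R).
  move=> ad; rewrite !add_deltaE.
  (* This is the coefficient of [t ^+ 2], up to sign: if it were nonzero, [c] would be its own
     ancestor. *)
  have cc0 : (d == c)%:R * (a == c)%:R = 0 :> R.
    have [dc|_] := eqVneq d c; last by rewrite mul0r.
    have [ac|_] := eqVneq a c; last by rewrite mulr0.
    by have := Anc_irrefl c acycP; rewrite -{1}ac -dc ad.
  transitivity (x 0 d * (1 - x 0 a) +
    t * ((d == c)%:R * (1 - x 0 a) - x 0 d * (a == c)%:R)
    - t ^+ 2 * ((d == c)%:R * (a == c)%:R)); first by ring.
  by rewrite cc0 mulr0 subr0.
have sumE d : \sum_(a in Anc P d) (x + t *: delta_mx 0 c) 0 d *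
                                 (1 - (x + t *: delta_mx 0 c) 0 a) =
    \sum_(a in Anc P d) x 0 d * (1 - x 0 a) +
    t * (\sum_(a in Anc P d) (d == c)%:R * (1 - x 0 a) -
         \sum_(a in Anc P d) x 0 d * (a == c)%:R).
  by rewrite -sumrB mulr_sumr -big_split; apply: eq_bigr => a /termE.
rewrite /Vanc; under eq_bigr do rewrite sumE.
rewrite big_split /= -mulr_sumr sumrB; congr (_ + t * (_ - _)).
  rewrite (bigD1 c) //= [X in _ + X]big1 ?addr0.
    by apply: eq_bigr => a _; rewrite eqxx mul1r.
  by move=> d /negPf dc; apply: big1 => a _; rewrite dc mul0r.
rewrite [RHS]big_mkcond /=; apply: eq_bigr => d _; rewrite -mulr_sumr.
have [cd|cd] := boolP (c \in Anc P d).
  rewrite (bigD1 c) //= eqxx big1 ?addr0 ?mulr1 //.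
  by move=> a /andP[_ /negPf ->].
rewrite big1 ?mulr0 // => a ad; have [ac|//] := eqVneq a c.
by rewrite -ac ad in cd.
Qed.

Lemma fhat_add_delta w gamma x c t : acyclic P ->
  fhat P w gamma (x + t *: delta_mx 0 c) =
  fhat P w gamma x + t * (gamma * Vanc_slope x c - w 0 c).
Proof.
move=> acycP; rewrite /fhat Vanc_add_delta //.
have -> : dot w (x + t *: delta_mx 0 c) = dot w x + t * w 0 c.
  rewrite /dot; under eq_bigr do rewrite add_deltaE mulrDr.
  rewrite big_split /=; congr (_ + _).
  rewrite (bigD1 c) //= eqxx big1 ?addr0 ?mulr1 1?mulrC //.
  by move=> d /negPf ->; rewrite !mulr0.
ring.
Qed.

Lemma dot_grad_Vanc_removal x c : acyclic P ->
  dot (grad (Vanc P) x) (- delta_mx 0 c) = - Vanc_slope x c.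
Proof.
move=> acycP; rewrite /dot (bigD1 c) //= big1 ?addr0.
  rewrite !mxE !eqxx mulrN mulr1; congr (- _).
  by apply: derive_affine => t; apply: Vanc_add_delta.
by move=> d /negPf dc; rewrite !mxE eqxx dc oppr0 mulr0.
Qed.

Lemma infeasible_removable x : acyclic P -> binary x -> ~ feasible P x ->
  exists2 c, x 0 c = 1 & 1 <= Vanc_slope x c.
Proof.
move=> acycP xbin /existsNP[i /existsNP[j /not_implyP[ji xij]]].
have [xi1 xj0] : x 0 i = 1 /\ x 0 j = 0.
  by case: (xbin i) (xbin j) xij => -> [] -> //; rewrite ?ler01 ?lexx.
pose bad c := (x 0 c == 1) && [exists a in Anc P c, x 0 a == 0].
have badi : bad i.
  rewrite /bad xi1 eqxx; apply/existsP; exists j.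
  by rewrite mem_Anc_prec // xj0 eqxx.
case: (@arg_maxnP _ i bad (fun c => #|Anc P c|) badi) => c.
move=> /andP[/eqP xc1 /existsP[a /andP[ac /eqP xa0]]] cmax.
exists c => //; rewrite /Vanc_slope [X in _ - X]big1 ?subr0.
  (* The inactive ancestor [a] alone contributes 1, and the other terms are nonnegative. *)
  rewrite (bigD1 a) //= xa0 subr0 lerDl sumr_ge0 // => b _.
  by case: (xbin b) => ->; rewrite ?subrr ?subr0.
move=> d cd; case: (xbin d) => // xd1.
have := card_Anc_lt acycP cd; rewrite ltnNge => /negP[]; apply: cmax.
rewrite /bad xd1 eqxx; apply/existsP; exists a.
by rewrite (Anc_trans ac cd) xa0 eqxx.
Qed.

End CoordinateSlope.

(** Since coordinate [c] is at its upper bound, it can be lowered slightly inside the box; a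
    positive slope would then decrease [f]. *)
Lemma local_minimizer_removal (R : realType) (n : nat) (f : 'rV[R]_n -> R)
    (x : 'rV[R]_n) (c : 'I_n) (s : R) :
  local_minimizer f x -> x 0 c = 1 ->
  (forall t, f (x + t *: delta_mx 0 c) = f x + t * s) -> s <= 0.
Proof.
move=> [xbox /nbhs_ballP[e /= e0 xmin]] xc1 fE.
(* The bound [e / 2] keeps the moved point inside the open ball, and the bound 1 keeps coordinate
   [c] nonnegative. *)
pose t := Num.min (e / 2) 1.
have t0 : 0 < t by rewrite lt_min divr_gt0 //= ltr01.
have te : t < e.
  by rewrite gt_min ltr_pdivrMr // mulr_natr mulr2n ltrDl e0.
have t1 : t <= 1 by rewrite ge_min lexx orbT.
have : f x <= f (x + (- t) *: delta_mx 0 c).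
  apply: xmin.
    split=> // i d; rewrite /ball /= (ord1 i) add_deltaE opprD addNKr -mulNr opprK.
    rewrite ger0_norm ?mulr_ge0 ?ler0n ?(ltW t0) //.
    by case: (_ == _); rewrite ?mulr1 ?mulr0.
  move=> d; rewrite add_deltaE; have [->|_] := eqVneq d c.
    by rewrite xc1 mulr1 subr_ge0 t1 gerDl oppr_le0 ltW.
  by rewrite mulr0 addr0.
by rewrite fE lerDl mulNr oppr_ge0 pmulr_rle0.
Qed.

Theorem proposition3p1 (R : realType) (n : nat) (P : 'I_n -> {set 'I_n})
  (acycP : acyclic P) (w : 'rV[R]_n) (gamma : R) (gamma_gt0 : 0 < gamma)
  (core : core_binarity (fhat P w gamma)) :
  locally_repairable P (Vanc P) 1 (@removal_directions R n) /\
  ((\big[maxe/-oo]_(i < n) (w 0 i)%:E < gamma%:E)%E ->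
   forall x : 'rV[R]_n, binary x -> local_minimizer (fhat P w gamma) x ->
     feasible P x).
Proof.
split.
  move=> x xbin /(infeasible_removable acycP xbin)[c xc1 slope1].
  exists (- delta_mx 0 c); last by rewrite dot_grad_Vanc_removal // lerN2.
  split; first by exists c.
  (* The only nonzero entry of the direction is negative and sits where [x] equals 1, so the
     direction is tangent. *)
  move=> i; rewrite !mxE eqxx; have [->|_] := eqVneq i c.
    by rewrite xc1; split=> [/eqP|_]; rewrite ?oner_eq0 ?oppr_le0.
  by rewrite oppr0.
move=> wmax x xbin xmin; apply: contrapT.
move=> /(infeasible_removable acycP xbin)[c xc1 slope1].
have wc : w 0 c < gamma.
  rewrite -lte_fin; apply: le_lt_trans wmax.
  exact: (@le_bigmax _ _ _ _ (fun i => (w 0 i)%:E)).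
have := local_minimizer_removal xmin xc1
  (fun t => fhat_add_delta w gamma x c t acycP).
(* The slope of [fhat] along [c] is positive, as [w 0 c < gamma] and [gamma] is at most
   [gamma * Vanc_slope x c]. *)
apply/negP; rewrite -ltNge subr_gt0; apply: lt_le_trans wc _.
by rewrite ler_peMr // ltW.
Qed.
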